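(* Let $n\ge2$ and let $X\subseteq2^{\mathbb{Z}}$ be a minimal subshift of topological rank $n$. Then $X$ has finite symbolic rank.
   Context: **Subshifts.** $2^{\mathbb{Z}}=\{0,1\}^{\mathbb{Z}}$ has the product topology, $\sigma(x)(n)=x(n+1)$. A subshift is a closed set $X\subseteq 2^{\mathbb{Z}}$ with $\sigma X=X$, identified with the system $(X,\sigma)$; it is minimal if every orbit is dense in $X$. For an infinite word $V\in\{0,1\}^{\mathbb{N}}$, $X_V=\{x\in 2^{\mathbb{Z}}:$ every finite subword of $x$ is a subword of $V\}$. **Finite symbolic rank.** Let $\mathcal{F}$ be the set of finite $0,1$-words that begin and end with $0$. For finite $S\subseteq\mathcal{F}$ and $w\in\mathcal{F}$, a building of $w$ from $S$ consists of $v_1,\dots,v_{k+1}\in S$ and nonnegative integers $s_1,\dots,s_k$, $k\ge 1$, with $w=v_1 1^{s_1}v_2\cdots v_k1^{s_k}v_{k+1}$; then $w$ is built from $S$ starting with $v_1$. For $n\ge1$, a rank-$n$ generating sequence is a family $\{v_{i,j}\}_{i\ge0,1\le j\le n_i}$ of finite words such that for all $i\ge 0$: $n_i\le n$; $v_{0,j}=0$ for all $1\le j\le n_0$; $v_{i+1,1}$ is built from $S_i=\{v_{i,1},\dots,v_{i,n_i}\}$ starting with $v_{i,1}$; and $v_{i+1,j}$ is built from $S_i$ for all $2\le j\le n_{i+1}$. A rank-$n$ construction is such a sequence together with one chosen building of each $v_{i+1,j}$ from $S_i$ (that of $v_{i+1,1}$ starting with $v_{i,1}$); it is a construction of the infinite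 word $V=\lim_i v_{i,1}$. A subshift $X$ has finite symbolic rank if, for some $n\ge1$, $X=X_V$ (equality, not merely conjugacy) for some $V$ having a rank-$n$ construction. **Topological rank.** A Cantor system $(X,T)$ is a homeomorphism $T$ of a Cantor space $X$ (zero-dimensional, perfect, compact metrizable); it is essentially minimal if it has a unique minimal set (nonempty closed set $Y$ with $TY=Y$, minimal among such sets). Systems $(X,T)$ and $(Y,S)$ are conjugate if there is a homeomorphism $\varphi:X\to Y$ with $\varphi T=S\varphi$. A Bratteli diagram $(V,E)$ consists of vertices $V=V_0\sqcup V_1\sqcup\cdots$ and edges $E=E_1\sqcup E_2\sqcup\cdots$, all $V_n,E_n$ finite nonempty, $V_0=\{v_0\}$, with maps $\mathsf{s},\mathsf{r}:E\to V$ satisfying $\mathsf{s}(E_n)=V_{n-1}$ and $\mathsf{r}(E_n)=V_n$ for $n\ge1$ (so every vertex is a source, and every vertex other than $v_0$ is a range). It is ordered if it carries a partial order $\preceq$ on $E$ in which $e,e'$ are comparable iff $\mathsf{r}(e)=\mathsf{r}(e')$. Let $X_B=\{(e_n)_{n\ge1}: e_n\in E_n,\ \mathsf{r}(e_n)=\mathsf{s}(e_{n+1})\}$ with the subspace topology of $\prod_n E_n$. The ordered diagram $B$ is essentially simple if there is a unique $x_{\max}\in X_B$ all of whose edges are $\preceq$-maximal and a unique $x_{\min}\in X_B$ all of whose edges are $\preceq$-minimal. Then the Vershik map $\lambda_B$ sends $x_{\max}$ to $x_{\min}$, and sends $(e_1,e_2,\dots)\ne x_{\max}$ to $(f_1,\dots,f_k,e_{k+1},\dots)$,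 where $k$ is least with $e_k$ not maximal, $f_k$ is the $\preceq$-successor of $e_k$, and $(f_1,\dots,f_{k-1})$ is the unique path of minimal edges from $v_0$ to $\mathsf{s}(f_k)$. An essentially minimal Cantor system has finite topological rank if it is conjugate to some $(X_B,\lambda_B)$ with $B$ essentially simple and $(|V_n|)_{n\ge1}$ bounded by some natural number $d$; the least possible $d$ is its topological rank. *)

(* Defs.v *)
From HB Require Import structures.
From mathcomp Require Import all_boot all_order all_algebra.
From mathcomp Require Import all_classical all_reals all_analysis.
From mathcomp Require Import Rstruct zify.

Set Implicit Arguments.
Unset Strict Implicit.
Unset Printing Implicit Defensive.

Import Order.TTheory GRing.Theory Num.Theory.

Local Open Scope classical_set_scope.
Local Open Scope ring_scope.

(** The library predicate [cantor_like] is "perfect, compact, Hausdorff and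
    zero-dimensional"; it does not include metrizability. *)
Definition metrizable (T : topologicalType) :=
  exists d : T -> T -> Rdefinitions.R,
    [/\ forall x y, (d x y = 0) <-> (x = y),
        forall x y, d x y = d y x,
        forall x y z, d x z <= d x y + d y z &
        forall (x : T) (U : set T),
          nbhs x U <-> exists2 e : Rdefinitions.R, 0 < e & [set y | d x y < e] `<=` U].

Definition cantor_set (T : topologicalType) := cantor_like T /\ metrizable T.

Definition homeomorphism (T U : topologicalType) (f : T -> U) :=
  continuous f /\ exists g : U -> T, [/\ continuous g, cancel f g & cancel g f].

Definition conjugate (T U : topologicalType) (f : T -> T) (g : U -> U) :=
  exists phi : T -> U, homeomorphism phi /\ phi \o f = g \o phi.

Definition invariant_closed (T : topologicalType) (f : T -> T) (Y : set T) :=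
  [/\ Y !=set0, closed Y & f @` Y = Y].

Definition minimal_set (T : topologicalType) (f : T -> T) (Y : set T) :=
  invariant_closed f Y /\
  forall Z, invariant_closed f Z -> Z `<=` Y -> Z = Y.

Definition cantor_system (T : topologicalType) (f : T -> T) :=
  cantor_set T /\ homeomorphism f.

Definition essentially_minimal (T : topologicalType) (f : T -> T) :=
  exists! Y : set T, minimal_set f Y.

Definition full_shift : topologicalType := {ptws int -> bool}.

Definition shift_map (x : full_shift) : full_shift := fun n => x (n + 1).

Definition shift_orbit (x : full_shift) : set full_shift :=
  [set y | exists k : int, y = (fun n => x (n + k))].

Definition subshift (X : set full_shift) := closed X /\ shift_map @` X = X.

Definition minimal_subshift (X : set full_shift) :=
  subshift X /\ forall x, X x -> X `<=` closure (shift_orbit x).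

Lemma shift_stable (X : set full_shift) (hX : subshift X) (x : X) :
  shift_map (\val x) \in X.
Proof.
by rewrite inE -[X in X _](proj2 hX); exists (\val x) => //; exact: set_valP.
Qed.

Definition subshift_map (X : set full_shift) (hX : subshift X) (x : X) : X :=
  exist _ (shift_map (\val x)) (shift_stable hX x).

(** Letters: [false] is 0 and [true] is 1. *)
Notation word := (seq bool).

Definition int_subword (x : full_shift) (a : int) (l : nat) : word :=
  mkseq (fun i => x (a + i%:Z)) l.

Definition nat_subword (V : nat -> bool) (a l : nat) : word :=
  mkseq (fun i => V (a + i)%N) l.

Definition word_subshift (V : nat -> bool) : set full_shift :=
  [set x | forall a l, exists b, int_subword x a l = nat_subword V b l].

Definition zero_ended : pred word :=
  [pred w | [&& w != [::], head true w == false & last true w == false]].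

(** The building [v_1 1^{s_1} v_2 ... 1^{s_k} v_{k+1}] is encoded by [v_1] and
    the list [(s_1, v_2), ..., (s_k, v_{k+1})]. *)
Record building := Building {
  building_head : word;
  building_tail : seq (nat * word)
}.

Definition building_word (b : building) : word :=
  building_head b ++
  flatten [seq nseq p.1 true ++ p.2 | p <- building_tail b].

Definition is_building (S : seq word) (w : word) (b : building) :=
  [/\ all zero_ended S, zero_ended w,
      building_tail b != [::],
      (building_head b \in S) && all (fun p => p.2 \in S) (building_tail b) &
      building_word b = w].

Definition built (S : seq word) (w : word) := exists b, is_building S w b.

Definition built_from (S : seq word) (w u : word) :=
  exists2 b, is_building S w b & building_head b = u.

(** A family [v_{i,j}], [1 <= j <= m_i], is given by the sizes [m] and a total
    function [v] whose values at other [j] are irrelevant. *)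
Definition level_words (m : nat -> nat) (v : nat -> nat -> word) (i : nat) :
  seq word := [seq v i j | j <- iota 1 (m i)].

Definition generating_sequence (n : nat) (m : nat -> nat)
    (v : nat -> nat -> word) :=
  [/\ forall i, (1 <= m i <= n)%N,
      forall j, (1 <= j <= m 0)%N -> v 0%N j = [:: false],
      forall i, built_from (level_words m v i) (v i.+1 1%N) (v i 1%N) &
      forall i j, (2 <= j <= m i.+1)%N ->
        built (level_words m v i) (v i.+1 j)].

Definition rank_construction (n : nat) (m : nat -> nat)
    (v : nat -> nat -> word) (b : nat -> nat -> building) :=
  [/\ generating_sequence n m v,
      forall i j, (1 <= j <= m i.+1)%N ->
        is_building (level_words m v i) (v i.+1 j) (b i.+1 j) &
      forall i, building_head (b i.+1 1%N) = v i 1%N].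

Definition word_limit (u : nat -> word) (V : nat -> bool) :=
  forall k, \forall i \near \oo,
    (k < size (u i))%N /\ nth false (u i) k = V k.

Definition construction_of (n : nat) (V : nat -> bool) :=
  exists m v b, rank_construction n m v b /\ word_limit (fun i => v i 1%N) V.

Definition finite_symbolic_rank (X : set full_shift) :=
  exists n V, [/\ (1 <= n)%N, construction_of n V & X = word_subshift V].

(** [vertex n] is [V_n] and [edge n] is [E_{n+1}]. That all levels are nonempty
    follows from [bratteli_root] and surjectivity of [src] and [rng]. *)
Record bratteli := Bratteli {
  vertex : nat -> finType;
  edge : nat -> finType;
  src : forall n, edge n -> vertex n;
  rng : forall n, edge n -> vertex n.+1;
  edge_le : forall n, rel (edge n);
  bratteli_root : #|vertex 0| = 1%N;
  src_surj : forall n (v : vertex n), exists e, src e = v;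
  rng_surj : forall n (v : vertex n.+1), exists e, rng e = v;
  edge_le_refl : forall n, reflexive (@edge_le n);
  edge_le_anti : forall n, antisymmetric (@edge_le n);
  edge_le_trans : forall n, transitive (@edge_le n);
  edge_le_comparable : forall n (e f : edge n),
    (edge_le e f || edge_le f e) = (rng e == rng f)
}.

Definition edge_max (B : bratteli) n (e : edge B n) :=
  forall f, edge_le e f -> f = e.

Definition edge_min (B : bratteli) n (e : edge B n) :=
  forall f, edge_le f e -> f = e.

Definition edge_succ (B : bratteli) n (e f : edge B n) :=
  [/\ edge_le e f, e != f &
      forall g, edge_le e g -> edge_le g f -> g = e \/ g = f].

Definition path_set (B : bratteli) :
    set (prod_topology (fun n => discrete_topology (edge B n))) :=
  [set x | forall n, rng (x n : edge B n) = src (x n.+1 : edge B n.+1)].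

Definition path_space (B : bratteli) : topologicalType := set_type (@path_set B).

Definition path_edge (B : bratteli) (x : path_space B) (n : nat) : edge B n :=
  (\val x : prod_topology _) n.

Definition path_max (B : bratteli) (x : path_space B) :=
  forall n, edge_max (path_edge x n).

Definition path_min (B : bratteli) (x : path_space B) :=
  forall n, edge_min (path_edge x n).

Definition essentially_simple (B : bratteli) :=
  (exists! x : path_space B, path_max x) /\
  (exists! x : path_space B, path_min x).

(** No condition relating [y] at [k - 1] to [y] at [k] is needed: [y] is a path. *)
Definition vershik_step (B : bratteli) (x y : path_space B) :=
  (path_max x /\ path_min y) \/
  exists k, [/\ forall i, (i < k)%N -> edge_max (path_edge x i),
                ~ edge_max (path_edge x k),
                edge_succ (path_edge x k) (path_edge y k),
                forall i, (i < k)%N -> edge_min (path_edge y i) &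
                forall i, (k < i)%N -> path_edge y i = path_edge x i].

Lemma edge_min_exists (B : bratteli) n (v : vertex B n.+1) :
  exists e : edge B n, rng e = v /\ edge_min e.
Proof.
have [e0 e0v] := rng_surj v.
case: (arg_minnP (P := fun e : edge B n => rng e == v)
  (fun e => #|[pred g | edge_le g e]|) (introT eqP e0v)) => e /eqP ev emin.
exists e; split=> // f fe; apply/eqP/negPn/negP => nfe.
have fv : rng f == v.
  by rewrite -ev -edge_le_comparable fe.
have := emin f fv; rewrite leqNgt => /negP; apply; apply: proper_card.
apply/properP; split.
  by apply/fintype.subsetP => g; rewrite !inE => /edge_le_trans; apply.
exists e; rewrite !inE ?edge_le_refl //; apply/negP => ef.
by move/eqP: nfe; apply; apply: edge_le_anti; rewrite fe ef.
Qed.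

Lemma edge_succ_exists (B : bratteli) n (e : edge B n) :
  ~ edge_max e -> exists f, edge_succ e f.
Proof.
move=> /existsNP[f0 /not_implyP[ef0 /eqP nf0]].
case: (arg_minnP (P := fun f : edge B n => edge_le e f && (f != e))
  (fun f => #|[pred g | edge_le g f]|) (introT andP (conj ef0 nf0))).
move=> f /andP[ef nfe] fmin; exists f; split=> //; first by rewrite eq_sym.
move=> g eg gf; have [->|nge] := eqVneq g e; first by left.
right; apply/eqP/negPn/negP => ngf.
have := fmin g; rewrite eg nge => /(_ isT).
rewrite leqNgt => /negP; apply; apply: proper_card.
apply/properP; split.
  by apply/fintype.subsetP => h; rewrite !inE => /edge_le_trans; apply.
exists f; rewrite !inE ?edge_le_refl //; apply/negP => fg.
by move/eqP: ngf; apply; apply: edge_le_anti; rewrite gf fg.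
Qed.

Lemma min_prefix_exists (B : bratteli) k (q : forall n, edge B n) :
  (forall n, (k <= n)%N -> rng (q n) = src (q n.+1)) ->
  exists y : forall n, edge B n,
    [/\ forall n, rng (y n) = src (y n.+1),
        forall n, (n < k)%N -> edge_min (y n) &
        forall n, (k <= n)%N -> y n = q n].
Proof.
elim: k q => [|k IHk] q hq; first by exists q; split=> // n; exact: hq.
have [e [eq emin]] := edge_min_exists (src (q k.+1)).
pose q' : forall n, edge B n := dfwith q k e.
have q'k : q' k = e by rewrite /q' dfwithin.
have q'N n : (k < n)%N -> q' n = q n.
  by move=> kn; rewrite /q' dfwithout // neq_ltn kn.
have [|y [yP ymin yq]] := IHk q'.
  move=> n; rewrite leq_eqVlt => /predU1P[<-|kn].
    by rewrite q'k q'N.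
  by rewrite !q'N ?hq // ltnW.
exists y; split=> // n; last by move=> kn; rewrite yq ?q'N // ltnW.
by rewrite ltnS leq_eqVlt => /predU1P[->|/ymin //]; rewrite yq ?q'k.
Qed.

Lemma vershik_step_total (B : bratteli) (hB : essentially_simple B)
  (x : path_space B) : exists y, vershik_step x y.
Proof.
have [xmax|/existsNP xmax] := pselect (path_max x).
  by have [_ [y [ymin _]]] := hB; exists y; left.
have {}xmax : exists n, ~~ `[<edge_max (path_edge x n)>].
  by have [n hn] := xmax; exists n; apply/asboolPn.
have xP n : rng (path_edge x n) = src (path_edge x n.+1) := set_valP x n.
case: (ex_minnP xmax) => k /asboolPn kN kmin.
have [f xf] := edge_succ_exists kN.
pose q : forall n, edge B n := dfwith (path_edge x) k f.
have qk : q k = f by rewrite /q dfwithin.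
have qN n : (k < n)%N -> q n = path_edge x n.
  by move=> kn; rewrite /q dfwithout // neq_ltn kn.
have [|y [yP ymin yq]] := @min_prefix_exists B k q.
  move=> n; rewrite leq_eqVlt => /predU1P[<-|kn].
    rewrite qk qN // -xP; apply/esym/eqP.
    by have [xlef _ _] := xf; rewrite -edge_le_comparable xlef.
  by rewrite !qN // ltnW.
have yin : (y : prod_topology _) \in @path_set B by rewrite inE.
exists (exist _ (y : prod_topology _) yin); right; exists k.
rewrite /path_edge /=; split=> //.
- move=> i ik; apply: contrapT => iN.
  by have := kmin i (introT (asboolPn _) iN); rewrite leqNgt ik.
- by rewrite yq // qk.
- by move=> i ki; rewrite yq ?qN // ltnW.
Qed.

Lemma edge_succ_fun (B : bratteli) n (e f g : edge B n) :
  edge_succ e f -> edge_succ e g -> f = g.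
Proof.
move=> [ef nef fS] [eg neg gS].
have /orP[fg|gf] : edge_le f g || edge_le g f.
  have ef' : rng e == rng f by rewrite -edge_le_comparable ef.
  have eg' : rng e == rng g by rewrite -edge_le_comparable eg.
  by rewrite edge_le_comparable -(eqP ef').
- by case: (gS f ef fg) => // fe; rewrite fe eqxx in nef.
- by case: (fS g eg gf) => // ge; rewrite ge eqxx in neg.
Qed.

Lemma edge_min_inj (B : bratteli) n (e f : edge B n) :
  edge_min e -> edge_min f -> rng e = rng f -> e = f.
Proof.
move=> emin fmin /eqP; rewrite -edge_le_comparable.
by case/orP => [/fmin|/emin ->].
Qed.

Lemma vershik_step_fun (B : bratteli) (hB : essentially_simple B)
    (x y z : path_space B) :
  vershik_step x y -> vershik_step x z -> y = z.
Proof.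
have path_inj (u w : path_space B) :
    (forall n, path_edge u n = path_edge w n) -> u = w.
  by move=> uw; apply/val_inj/functional_extensionality_dep.
have pathP (u : path_space B) n :
  rng (path_edge u n) = src (path_edge u n.+1) := set_valP u n.
case=> [[xmax ymin]|[k [kmax kN yS ymin yx]]].
  case=> [[_ zmin]|[k [_ kN _ _ _]]]; last by case: (kN (xmax k)).
  by have [_ [m [_ um]]] := hB; rewrite -(um y) // -(um z).
case=> [[xmax _]|[k' [kmax' kN' zS zmin zx]]].
  by case: (kN (xmax k)).
have kk' : k = k' by case: (ltngtP k k') => // [/kmax'|/kmax].
subst k'; apply: path_inj => i.
have [ik|ki] := leqP i k; last by rewrite yx ?zx.
rewrite -(subKn ik); elim: (k - i)%N => [|j IHj].
  by rewrite subn0; exact: edge_succ_fun yS zS.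
have [kj|jk] := leqP k j.
  by move: IHj; have -> : (k - j.+1 = k - j)%N by lia.
have kj : (k - j = (k - j.+1).+1)%N by lia.
have lek : (k - j.+1 < k)%N by lia.
apply: edge_min_inj; [exact: ymin|exact: zmin|].
by rewrite !pathP -kj IHj.
Qed.

Definition vershik_map (B : bratteli) (hB : essentially_simple B)
    (x : path_space B) : path_space B :=
  sval (cid (vershik_step_total hB x)).

Definition topological_rank_le (T : topologicalType) (f : T -> T) (d : nat) :=
  [/\ cantor_system f, essentially_minimal f &
      exists (B : bratteli) (hB : essentially_simple B),
        conjugate f (vershik_map hB) /\ forall n, (#|vertex B n.+1| <= d)%N].

Definition topological_rank (T : topologicalType) (f : T -> T) (n : nat) :=
  topological_rank_le f n /\ forall d, topological_rank_le f d -> (n <= d)%N.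

(* Main.v *)
(** For [k >= 1] let C_k be the set of [x] in [X] whose path starts with [k]
    minimal edges. The C_k decrease to the point [x0] with minimal path, and an
    [x] in C_k has its first return time and its letters up to that time
    determined by the vertex of its path at level [k]; so, for [k] large, points
    of [X] are concatenations of at most [n] return words of level [k].
    Since C_k shrinks to [x0], for [k] large all points of C_k agree with [x0]
    on a window [[- b - 1, a]], where [a >= 0] and [- b - 1 < 0] are the
    positions of the zeros of [x0] closest to the cut. Removing the first [a]
    and the last [b] letters, which are ones, from all return words makes them
    begin and end with 0 and be separated by [1^(a + b)]. For [l] much larger
    than [k], the return words of level [l] are built from those of level [k],
    with the word of [x0] first. The limit word is [x0] read from [a] onwards. *)

Require Import Defs.
From mathcomp Require Import all_boot all_classical topology.
From mathcomp Require Import order ssralg ssrnum ssrint zify.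

Import Order.TTheory GRing.Theory Num.Theory.
Local Open Scope classical_set_scope.

(** * Uniform bounds by compactness; words and constructions *)

(** Compactness in its near-covering form, with the filter at infinity on the indices, turns a bound
    valid near each point into a uniform one. The uniform constants below come from here. *)
Lemma compact_nondecreasing_cover (T : topologicalType) (Q : nat -> set T) :
  compact [set: T] -> (forall k l, (k <= l)%N -> Q k `<=` Q l) ->
  (forall x : T, exists k, nbhs x (Q k)) -> exists k, forall x, Q k x.
Proof.
move=> /compact_near_coveringP cT Qmon Qnear.
have [|N _ hN] := cT _ \oo (fun k x => Q k x) _.
  move=> x _; have [k xk] := Qnear x.
  exists (Q k, [set l | (k <= l)%N]) => /=; last first.
    by move=> [y l] /= [Qy kl]; exact: Qmon kl _ Qy.
  by split=> //; exists k.
by exists N => x; exact: (hN N (leqnn N) x I).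
Qed.

Lemma mkseq_add (A : Type) (f : nat -> A) m n :
  mkseq f (m + n) = mkseq f m ++ mkseq (fun i => f (m + i)%N) n.
Proof. by rewrite /mkseq iotaD map_cat add0n -{2}[m]addn0 iotaDl -map_comp. Qed.

(** Each 0 closes a block [1^s 0]; a leading 1 raises the exponent of the first block of the
    remaining word. *)
Lemma building_over_zero (s : word) : last false s = false ->
  exists t : seq (nat * word), [/\ all (fun p => p.2 \in [:: [:: false]]) t,
    s = flatten [seq nseq p.1 true ++ p.2 | p <- t] & s != [::] -> t != [::]].
Proof.
elim: s => [|c s IHs] /= sE; first by exists [::].
case: c sE => sE; last first.
  have [t [tP sEt _]] := IHs sE.
  by exists ((0%N, [:: false]) :: t); split=> //=; rewrite sEt.
case: s sE IHs => // d s sE /(_ sE)[[|[i w] t] [/= tP -> tN]].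
  by have := tN isT.
by exists ((i.+1, w) :: t).
Qed.

(** The head of each list plays the role of [v_(i,1)]. Requiring all words of a level to start with
    the head of the level below treats the first word and the others alike. *)
Lemma construction_of_levels n (W : nat -> seq word) (V : nat -> bool) :
  W 0%N = [:: [:: false]] -> (forall i, (1 <= size (W i) <= n)%N) ->
  (forall i w, w \in W i.+1 -> exists2 bd, is_building (W i) w bd &
    building_head bd = head [::] (W i)) ->
  word_limit (fun i => head [::] (W i)) V -> construction_of n V.
Proof.
move=> W0 Wsize Wbuilt Wlim.
pose m i := size (W i); pose v i j := nth [::] (W i) j.-1.
have levelE i : level_words m v i = W i.
  rewrite /level_words -[1%N]addn0 iotaDl -map_comp.
  exact: (mkseq_nth [::] (W i)).
have v1 i : v i 1%N = head [::] (W i) by rewrite /v nth0.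
(* The guard on [j] makes the choice total: outside the range a dummy building serves. *)
have /choice[b bP] (ij : nat * nat) : exists bd, (1 <= ij.2 <= m ij.1.+1)%N ->
    is_building (W ij.1) (v ij.1.+1 ij.2) bd /\ building_head bd = v ij.1 1%N.
  case: ij => [i j] /=; have [jm|jm] := boolP (1 <= j <= m i.+1)%N; last first.
    by exists (Building [::] [::]).
  have [|bd bdP bdh] := Wbuilt i (v i.+1 j).
    by case/andP: jm => j1 jm; apply: mem_nth; rewrite prednK.
  by exists bd; rewrite v1.
have m1 i : (1 <= 1 <= m i)%N by have /andP[] := Wsize i.
exists m, v, (fun i j => b (i.-1, j)); split; last first.
  by move=> k; have [N _ hN] := Wlim k; exists N => // i /hN /=; rewrite v1.
split=> [|i j ij|i].
- split=> [||i|i j ij].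
  + exact: Wsize.
  + by move=> j; rewrite /m /v W0 /= => /andP[j1 j1']; have -> : j = 1%N by [lia].
  + rewrite levelE; have [bdP bdh] := bP (i, 1%N) (m1 i.+1).
    by exists (b (i, 1%N)).
  + rewrite levelE; have [|bdP _] := bP (i, j); first by rewrite /=; lia.
    by exists (b (i, j)).
- by rewrite levelE; have [] := bP (i, j) ij.
- by have [] := bP (i, 1%N) (m1 i.+1).
Qed.

(** * Minimal subshifts *)

Section Subshift.
Set Implicit Arguments.
Unset Strict Implicit.
Local Open Scope ring_scope.
Variables (X : set full_shift) (hX : subshift X).
Local Notation T := (subshift_map hX).

Definition letter (x : X) (i : int) : bool := (\val x : full_shift) i.

Definition agree (m : nat) (x : X) (y : full_shift) :=
  forall i : int, (`|i| <= m)%N -> letter x i = y i.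

Lemma letter_inj (x y : X) : (forall i, letter x i = letter y i) -> x = y.
Proof. by move=> xy; apply/val_inj/funext => i; exact: xy. Qed.

Lemma letter_iter t (x : X) i : letter (iter t T x) i = letter x (i + t%:Z).
Proof.
elim: t i => [|t IHt] i; first by rewrite addr0.
rewrite iterS -[LHS]/(letter (iter t T x) (i + 1)) IHt.
by congr (letter x _); lia.
Qed.

Lemma unshift (x : X) t :
  exists y : X, forall i, letter y i = letter x (i - t%:Z).
Proof.
elim: t => [|t [y yx]]; first by exists x => i; rewrite subr0.
have : (shift_map @` X) (\val y) by rewrite (proj2 hX); exact: set_valP.
move=> [z Xz zy]; exists (exist _ z (mem_set Xz)) => i.
have zi : z ((i - 1) + 1) = letter y (i - 1) by rewrite /letter -zy.
by rewrite /letter /= -[i](subrK 1) zi yx; congr (letter x _); lia.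
Qed.

Lemma agreeW m m' (x : X) y : (m <= m')%N -> agree m' x y -> agree m x y.
Proof. by move=> mm' xy i im; apply: xy; apply: leq_trans im mm'. Qed.

Lemma nbhs_window m (y : full_shift) :
  nbhs y [set z : full_shift | forall i : int, (`|i| <= m)%N -> z i = y i].
Proof.
have near1 (i : int) : nbhs y [set z : full_shift | z i = y i].
  exact: (@proj_continuous int (fun=> bool) i y [set y i] (discrete_set1 (y i))).
elim: m => [|m IHm].
  by apply: filterS (near1 0) => z z0 i; rewrite leqn0 absz_eq0 => /eqP ->.
near=> z => i im.
have [->|->|im'] : [\/ i = m.+1%:Z, i = - m.+1%:Z | (`|i| <= m)%N].
- have [|] := leqP `|i|%N m; first by constructor 3.
  by case: (ltrP i 0) => ? ?; [constructor 2 | constructor 1]; lia.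
- by clear im; near: z; exact: near1.
- by clear im; near: z; exact: near1.
- by clear im; move: i im'; near: z; exact: IHm.
Unshelve. all: by end_near. Qed.

Lemma nbhs_agree m (x : X) : nbhs x [set y | agree m y (\val x)].
Proof. exact: (@initial_continuous _ _ set_val x _ (nbhs_window m (\val x))). Qed.

Section Minimal.
Hypothesis cX : compact [set: X].
Hypothesis pX : perfect_set [set: X].
Hypothesis minX : forall x, X x -> X `<=` closure (shift_orbit x).

Lemma not_isolated m (x : X) : exists y : X, y <> x /\ agree m y (\val x).
Proof.
have [_ lX] := pX.
have : limit_point [set: X] x by rewrite lX.
by move=> /(_ _ (nbhs_agree m x))[y [/eqP yx _ yx']]; exists y.
Qed.

(** By minimality the orbit of [z] meets the cylinder of [y]; the same time serves for all points
    near [z], so compactness bounds it. *)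
Lemma bounded_recurrence m (y : X) : exists M, forall z : X, exists k : int,
  (`|k| <= M)%N /\ forall i : int, (`|i| <= m)%N -> letter z (i + k) = letter y i.
Proof.
apply: (@compact_nondecreasing_cover _ (fun M z => exists k : int,
  (`|k| <= M)%N /\ forall i : int, (`|i| <= m)%N -> letter z (i + k) = letter y i) cX).
  by move=> k l kl z [j [jk hj]]; exists j; split=> //; apply: leq_trans jk kl.
move=> z; have := minX (set_valP z) (set_valP y) (nbhs_window m (\val y)).
move=> [_ [[k ->] /= zy]]; exists `|k|%N.
apply: filterS (nbhs_agree (m + `|k|) z) => w wz; exists k; split=> // i im.
by rewrite wz; [exact: zy | lia].
Qed.

Lemma forward_recurrence m N (x y : X) :
  exists t, (N <= t)%N /\ agree m (iter t T x) (\val y).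
Proof.
(* The recurrence time may be negative, but it goes back by at most [M]; starting from [N + M]
   leaves a time of at least [N]. *)
have [M /(_ (iter (N + M) T x))[k [kM xy]]] := bounded_recurrence m y.
exists `|((N + M)%N%:Z + k)%R|%N; split; first by lia.
move=> i im; rewrite -[RHS]/(letter y i) -xy // !letter_iter.
by congr (letter x _); lia.
Qed.

(** If [x] had only ones, recurrence would make every point equal to [x], which is not isolated. *)
Lemma exists_zero (x : X) : exists i, letter x i = false.
Proof.
apply: contrapT => /forallNP x1.
have {}x1 i : letter x i = true by have := x1 i; case: (letter x i).
have [y [yx _]] := not_isolated 0 x; apply: yx; apply: letter_inj => i.
have [t [_ xy]] := forward_recurrence `|i| 0 x y.
by rewrite -[LHS]xy // letter_iter !x1.
Qed.

Lemma exists_nonneg_zero (x : X) : exists a : nat, letter x a = false.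
Proof.
have [i xi] := exists_zero x.
have [t [it xx]] := forward_recurrence `|i| `|i| x x.
exists `|(i + t%:Z)%R|%N; rewrite -xi -[RHS]xx // letter_iter.
by congr (letter x _); lia.
Qed.

Lemma exists_neg_zero (x : X) : exists b : nat, letter x (- b.+1%:Z) = false.
Proof.
have [i xi] := exists_zero x.
have [M recM] := bounded_recurrence `|i| x.
(* Moving [x] this far to the right puts every zero that recurrence can find at a negative position
   of [x]. *)
have [z zx] := unshift x (M + `|i|).+1.
have [k [kM /(_ i (leqnn _))]] := recM z.
rewrite xi zx => {}xi; exists `|(i + k - (M + `|i|)%N.+1%:Z)%R|%N.-1.
by rewrite -xi; congr (letter x _); lia.
Qed.

(** A period of [x] passes to every point by recurrence; a point agreeing with [x] on a window of
    radius [r] is then [x] itself, so [x] would be isolated. *)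
Lemma aperiodic (x : X) (r : nat) : (0 < r)%N ->
  exists i, letter x i <> letter x (i + r%:Z).
Proof.
move=> r0; apply: contrapT => /forallNP xper.
have {}xper i : letter x i = letter x (i + r%:Z) by apply: contrapT; exact: xper.
have per (y : X) i : letter y i = letter y (i + r%:Z).
  have [t [_ xy]] := forward_recurrence (`|i| + r) 0 x y.
  rewrite -[LHS]xy -?[RHS]xy; [|lia..].
  by rewrite !letter_iter [LHS]xper; congr (letter x _); lia.
have perM (y : X) i (q : nat) : letter y i = letter y (i + (q * r)%:Z).
  elim: q => [|q IHq]; first by rewrite mul0n addr0.
  by rewrite IHq per; congr (letter y _); lia.
have [y [yx yx']] := not_isolated r x; apply: yx; apply: letter_inj => i.
(* [j] is the remainder of [i] modulo [r] taken with the sign of [i], so that the quotient [q] is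
   natural in both cases. *)
have [j jr [q ij]] : exists2 j : int, (`|j| <= r)%N &
    exists q : nat, i = j + (q * r)%:Z \/ j = i + (q * r)%:Z.
  have nmod (n : nat) : (n = n %/ r * r + n %% r)%N := divn_eq n r.
  have nlt (n : nat) : (n %% r < r)%N := ltn_pmod n r0.
  case: i => n.
    exists (n %% r)%N%:Z; first by have := nlt n; lia.
    by exists (n %/ r)%N; left; rewrite {1}(nmod n); lia.
  exists (- (n.+1 %% r)%N%:Z); first by have := nlt n.+1; lia.
  by exists (n.+1 %/ r)%N; right; rewrite NegzE {2}(nmod n.+1); lia.
have ij_eq (z : X) : letter z i = letter z j.
  by case: ij => ->; rewrite -perM.
by rewrite !ij_eq; exact: yx'.
Qed.

Lemma word_subshift_forward_word (a : nat) (x : X) :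
  X = word_subshift (fun k => letter x (a + k)%N%:Z).
Proof.
apply/seteqP; split=> [y Xy p l|z zV].
  pose y' : X := exist _ y (mem_set Xy).
  have [t [tN xy]] := forward_recurrence (`|p| + l) (`|p| + a) x y'.
  exists (`|(p + t%:Z)%R| - a)%N.
  apply: (@eq_from_nth _ false); rewrite !size_mkseq // => i il.
  rewrite !nth_mkseq // -[LHS](xy (p + i%:Z)); last by lia.
  by rewrite letter_iter; congr (letter x _); lia.
apply: contrapT => zX.
(* A point [z] outside [X] differs from all points of [X] within one window, whereas its word there
   occurs in [x]. *)
have [||m mN] := @compact_nondecreasing_cover _ (fun m (y : X) => ~ agree m y z) cX.
- by move=> m n mn y yN /(agreeW mn).
- move=> y; have [yz|/existsNP[i iN]] := pselect (forall i, letter y i = z i).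
    by case: zX; have <- : \val y = z; [exact: funext | exact: set_valP].
  exists `|i|%N; apply: filterS (nbhs_agree `|i| y) => w wy wz; apply: iN.
  by rewrite -[LHS]wy ?wz.
have [b zb] := zV (- m%:Z) (m + m).+1.
apply: (mN (iter (a + b + m) T x)) => i im; rewrite letter_iter.
have := congr1 (fun s => nth false s `|(i + m%:Z)%R|) zb.
have im2 : (`|(i + m%:Z)%R| < (m + m).+1)%N by lia.
rewrite !nth_mkseq //.
have -> : - m%:Z + `|(i + m%:Z)%R|%N%:Z = i by lia.
by move=> ->; congr (letter x _); lia.
Qed.

End Minimal.
End Subshift.
(** * Initial segments of paths and the Vershik map *)

Section Paths.
Set Implicit Arguments.
Unset Strict Implicit.
Variables (B : bratteli) (hB : essentially_simple B).
Implicit Types (p q : path_space B) (k : nat).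

Definition edges_agree k p q :=
  forall i, (i < k)%N -> path_edge p i = path_edge q i.

Definition max_prefix k p := forall i, (i < k)%N -> edge_max (path_edge p i).

Definition min_prefix k p := forall i, (i < k)%N -> edge_min (path_edge p i).

Lemma path_edge_inj p q : (forall i, path_edge p i = path_edge q i) -> p = q.
Proof. by move=> pq; apply/val_inj/functional_extensionality_dep. Qed.

Lemma rng_path_edge p k : rng (path_edge p k) = src (path_edge p k.+1).
Proof. exact: (set_valP p k). Qed.

Lemma edges_agreeW k l p q :
  (k <= l)%N -> edges_agree l p q -> edges_agree k p q.
Proof. by move=> kl pq i ik; apply: pq; apply: leq_trans ik kl. Qed.

Lemma max_prefixW k l p : (k <= l)%N -> max_prefix l p -> max_prefix k p.
Proof. by move=> kl pmax i ik; apply: pmax; apply: leq_trans ik kl. Qed.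

Lemma min_prefixW k l p : (k <= l)%N -> min_prefix l p -> min_prefix k p.
Proof. by move=> kl pmin i ik; apply: pmin; apply: leq_trans ik kl. Qed.

Lemma max_prefix_agree k p q :
  edges_agree k p q -> max_prefix k p -> max_prefix k q.
Proof. by move=> pq pmax i ik; rewrite -pq //; exact: pmax. Qed.

(** A minimal edge is determined by its range, so the end vertex determines the segment, edge by
    edge backwards. *)
Lemma min_prefix_eq k p q : min_prefix k p -> min_prefix k q ->
  src (path_edge p k) = src (path_edge q k) -> edges_agree k p q.
Proof.
elim: k => [//|k IHk] pmin qmin; rewrite -!rng_path_edge => pqk.
have pq : path_edge p k = path_edge q k.
  by apply: edge_min_inj pqk; [exact: pmin | exact: qmin].
move=> i; rewrite ltnS leq_eqVlt => /predU1P[-> //|]; apply: IHk.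
- exact: min_prefixW pmin.
- exact: min_prefixW qmin.
- by rewrite pq.
Qed.

Lemma vershik_mapP p : vershik_step p (vershik_map hB p).
Proof. exact: svalP (cid (vershik_step_total hB p)). Qed.

Lemma vershik_min_prefix k p :
  max_prefix k p -> min_prefix k (vershik_map hB p).
Proof.
case: (vershik_mapP p) => [[_ pmin] _ i _|[j [_ jN _ jmin _]] pmax i ik].
  exact: pmin.
by apply: jmin; apply: leq_trans ik _; rewrite leqNgt; apply/negP => /pmax.
Qed.

(** The first non-maximal edge has index below [k] and is the same for both paths. It gets the same
    successor, and the minimal edges before it are determined by the source of that successor. *)
Lemma vershik_edges_agree k p q : edges_agree k p q -> ~ max_prefix k p ->
  edges_agree k (vershik_map hB p) (vershik_map hB q).
Proof.
move=> pq pN; have qN : ~ max_prefix k q.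
  by move/(max_prefix_agree (fun i ik => esym (pq i ik))).
case: (vershik_mapP p) => [[pmax _]|[j [pmax jN pS pmin pE]]].
  by case: pN => i _; exact: pmax.
case: (vershik_mapP q) => [[qmax _]|[j' [qmax jN' qS qmin qE]]].
  by case: qN => i _; exact: qmax.
have jk : (j < k)%N.
  by rewrite ltnNge; apply/negP => kj; apply/pN => i ik; apply/pmax/leq_trans/kj.
have jk' : (j' < k)%N.
  by rewrite ltnNge; apply/negP => kj; apply/qN => i ik; apply/qmax/leq_trans/kj.
have jj' : j' = j.
  case: (ltngtP j j') => // [/qmax|/pmax]; first by rewrite -pq.
  by rewrite pq.
subst j'; move=> i ik; have [ij|] := ltnP j i; first by rewrite pE // qE // pq.
have pqj : path_edge (vershik_map hB p) j = path_edge (vershik_map hB q) j.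
  by apply: edge_succ_fun pS _; rewrite pq.
rewrite leq_eqVlt => /predU1P[-> //|]; apply: min_prefix_eq => //.
by rewrite pqj.
Qed.

Lemma nbhs_edges_agree k p : nbhs p [set q | edges_agree k q p].
Proof.
have near1 i : nbhs p [set q | path_edge q i = path_edge p i].
  apply: (@initial_continuous _ _ set_val p [set q | q i = path_edge p i]).
  exact: (@proj_continuous nat (fun n => discrete_topology (edge B n)) i
    (\val p) [set path_edge p i] (discrete_set1 _)).
elim: k => [|k IHk]; first by apply: filterS filterT => q _ i.
near=> q => i; rewrite ltnS leq_eqVlt => /predU1P[->|].
  by near: q; exact: near1.
by move: i; near: q; exact: IHk.
Unshelve. all: by end_near. Qed.

End Paths.
(** * First returns to the sets of paths with minimal initial segments *)

Section Towers.
Set Implicit Arguments.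
Unset Strict Implicit.
Local Open Scope ring_scope.
Variables (X : set full_shift) (hX : subshift X).
Local Notation T := (subshift_map hX).
Hypothesis cX : compact [set: X].
Hypothesis pX : perfect_set [set: X].
Hypothesis minX : forall x, X x -> X `<=` closure (shift_orbit x).
Variables (B : bratteli) (hB : essentially_simple B).
Variables (phi : X -> path_space B) (psi : path_space B -> X).
Hypothesis phi_cont : continuous phi.
Hypotheses (phiK : cancel phi psi) (psiK : cancel psi phi).
Hypothesis phiT : forall x, phi (T x) = vershik_map hB (phi x).
Variable x0 : X.
Hypothesis x0P : forall x, path_min (phi x) -> x = x0.

Local Notation peq k x y := (edges_agree k (phi x) (phi y)).
(** [cut k] is the set C_k, the base of the towers of level [k]; [top k] is their roof, which [T]
    sends into [cut k]. *)
Local Notation cut k x := (min_prefix k (phi x)).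
Local Notation top k x := (max_prefix k (phi x)).

Lemma nbhs_peq k x : nbhs x [set y | peq k y x].
Proof. exact: phi_cont (nbhs_edges_agree k (phi x)). Qed.

Lemma cut_shrink U : nbhs x0 U -> exists k, forall x, cut k x -> U x.
Proof.
move=> x0U; apply: (@compact_nondecreasing_cover _ (fun k x => cut k x -> U x) cX).
  by move=> k l kl x kx /(min_prefixW kl).
move=> x; have [/x0P ->|/existsNP[k kN]] := pselect (path_min (phi x)).
  by exists 0%N; apply: filterS x0U.
exists k.+1; apply: filterS (nbhs_peq k.+1 x) => y yx ymin; case: kN.
by rewrite -yx //; exact: ymin.
Qed.

(** Only [x] itself has the path of [x]; any other point is separated from [x] by an edge, and so
    are its neighbours. *)
Lemma peq_letter0_at x : exists k, forall y, peq k y x -> letter y 0 = letter x 0.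
Proof.
apply: (@compact_nondecreasing_cover _
  (fun k y => peq k y x -> letter y 0 = letter x 0) cX).
  by move=> k l kl y ky /(edges_agreeW kl).
move=> y; have [yx|] := pselect (forall i, path_edge (phi y) i = path_edge (phi x) i).
  have {yx} -> : y = x by apply: (can_inj phiK); exact: path_edge_inj.
  by exists 0%N; apply: filterS (nbhs_agree 0 x) => z zx _; exact: zx.
move=> /existsNP[k kN]; exists k.+1.
by apply: filterS (nbhs_peq k.+1 y) => z zy zx; case: kN; rewrite -zy ?zx.
Qed.

Lemma peq_letter0 : exists k, forall x y, peq k x y -> letter x 0 = letter y 0.
Proof.
apply: (@compact_nondecreasing_cover _
  (fun k x => forall y, peq k x y -> letter x 0 = letter y 0) cX).
  by move=> k l kl x kx y /(edges_agreeW kl); exact: kx.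
move=> x; have [k kx] := peq_letter0_at x; exists k.
apply: filterS (nbhs_peq k x) => y yx z yz; rewrite (kx y yx) (kx z) // => i ik.
by rewrite -yz ?yx.
Qed.

Lemma agree_peq k x : exists m, forall y, agree m y (\val x) -> peq k y x.
Proof.
apply: (@compact_nondecreasing_cover _
  (fun m y => agree m y (\val x) -> peq k y x) cX).
  by move=> m n mn y my /(agreeW mn).
move=> y; have [yx|] := pselect (forall i, letter y i = letter x i).
  have {yx} -> : y = x by exact: letter_inj.
  by exists 0%N; apply: filterS (nbhs_peq k x).
move=> /existsNP[i iN]; exists `|i|%N.
by apply: filterS (nbhs_agree `|i| y) => z zy zx; case: iN; rewrite -[LHS]zy ?zx.
Qed.

(** The orbit of [x] comes close to the point with maximal path, and by continuity of [phi]
    closeness forces equal initial edges. *)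
Lemma top_reached k x : exists t, `[<top k (iter t T x)>].
Proof.
have [[p [pmax _]] _] := hB.
have [m mp] := agree_peq k (psi p).
have [t [_ /mp tp]] := forward_recurrence hX cX minX m 0 x (psi p).
exists t; apply/asboolP; apply: max_prefix_agree (fun i ik => esym (tp i ik)) _.
by rewrite psiK => i _; exact: pmax.
Qed.

(** The first return time to [cut k] when [x] lies in it. Counting up to the roof makes it a
    function of the first [k] edges. *)
Definition ret k x := (ex_minn (top_reached k x)).+1.

Lemma top_ret k x : top k (iter (ret k x).-1 T x).
Proof. by rewrite /ret; case: ex_minnP => t /asboolP. Qed.

Lemma ret_min k x t : top k (iter t T x) -> (ret k x <= t.+1)%N.
Proof. by rewrite /ret ltnS; case: ex_minnP => s _ + /asboolP; apply. Qed.

Lemma cut_ret k x : cut k (iter (ret k x) T x).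
Proof. by rewrite /ret /= phiT; apply: vershik_min_prefix; exact: top_ret. Qed.

Lemma ret_mono k l x : (k <= l)%N -> (ret k x <= ret l x)%N.
Proof. by move=> kl; apply/ret_min/(max_prefixW kl)/top_ret. Qed.

Lemma peq_iter k x y t : peq k x y -> (t < ret k x)%N ->
  peq k (iter t T x) (iter t T y).
Proof.
move=> xy; elim: t => [//|t IHt] tx; rewrite !iterS !phiT.
apply: vershik_edges_agree; first by apply: IHt; exact: ltnW.
by move=> /ret_min; rewrite leqNgt tx.
Qed.

Lemma peq_ret k x y : peq k x y -> ret k x = ret k y.
Proof.
have le u v : peq k u v -> (ret k v <= ret k u)%N.
  move=> uv; apply: (@ret_min _ _ (ret k u).-1).
  exact: max_prefix_agree (peq_iter uv (leqnn _)) (@top_ret k u).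
by move=> xy; apply/eqP; rewrite eqn_leq !le // => i ik; rewrite xy.
Qed.

(** Return times are excluded one by one: if [x] and [T^(m+1) x] were both close to [x0], the
    letters of [x0] at [i] and [i + m + 1] would agree, against aperiodicity. *)
Lemma ret_gt m : exists k, forall l x, (k <= l)%N -> cut l x -> (m < ret l x)%N.
Proof.
suff [k hk] : exists k, forall x t, cut k x -> (0 < t <= m)%N ->
    ~ cut k (iter t T x).
  exists k => l x kl lx; rewrite ltnNge; apply/negP => rm.
  by apply: (hk x (ret l x)) => //; apply: (min_prefixW kl); last exact: cut_ret.
elim: m => [|m [k hk]].
  by exists 0%N => x t _; rewrite leqn0 lt0n => /andP[/negP].
have [i xi] := aperiodic hX cX pX minX x0 (ltn0Sn m).
have [l hl] := cut_shrink (nbhs_agree (`|i| + m.+1) x0).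
exists (maxn k l) => x t xmin /andP[t0].
rewrite leq_eqVlt => /predU1P[->|tm] tmin; last first.
  apply: (hk x t); [|by rewrite t0| ].
    exact: min_prefixW (leq_maxl k l) xmin.
  exact: min_prefixW (leq_maxl k l) tmin.
have /hl tx := min_prefixW (leq_maxr k l) tmin.
have /hl xx := min_prefixW (leq_maxr k l) xmin.
have ti : letter (iter m.+1 T x) i = letter x0 i by apply: tx; lia.
have xi' : letter x (i + m.+1%:Z) = letter x0 (i + m.+1%:Z) by apply: xx; lia.
by apply: xi; rewrite -ti -xi' letter_iter.
Qed.

(** Agreement with [x0] makes all words of level [l] start with the same word of level [k]; the
    strict inequality makes them consist of at least two words. *)
Lemma next_level k : exists l, [/\ (k < l)%N,
  forall x, cut l x -> peq k x x0 & forall x, cut l x -> (ret k x < ret l x)%N].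
Proof.
have [l1 hl1] := cut_shrink (nbhs_peq k x0).
have [l2 hl2] := ret_gt (ret k x0).
exists (maxn k.+1 (maxn l1 l2)).
have xx x : cut (maxn k.+1 (maxn l1 l2)) x -> peq k x x0.
  by move=> xmin; apply: hl1; apply: min_prefixW xmin; lia.
split=> // [|x xmin]; first exact: leq_maxl.
by rewrite (peq_ret (xx x xmin)); apply: hl2 xmin; lia.
Qed.

(** * Return words *)

Section Words.
Variables (K a b : nat).
Hypothesis letter0K : forall x y, peq K x y -> letter x 0 = letter y 0.
Hypothesis x0a : letter x0 a = false.
Hypothesis x0b : letter x0 (- b.+1%:Z) = false.
Hypothesis x0ab : forall i : int, - b%:Z <= i < a%:Z -> letter x0 i = true.

Definition return_word k x : word :=
  mkseq (fun i => letter x (a + i)%N%:Z) (ret k x - b - a).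

(** The radius [a + b + 1] reaches both zeros of [x0] next to the cut, and the bound on [ret] leaves
    at least two letters after trimming. *)
Definition good_level k := (K <= k)%N /\ forall x, cut k x ->
  agree (a + b).+1 x (\val x0) /\ ((a + b).+1 < ret k x)%N.

Lemma good_levelW k l : (k <= l)%N -> good_level k -> good_level l.
Proof.
move=> kl [Kk hk]; split=> [|x /(min_prefixW kl)/hk[xx xr]].
  exact: leq_trans kl.
by split=> //; apply: leq_trans xr (ret_mono x kl).
Qed.

Lemma good_level_exists : exists k, good_level k.
Proof.
have [k hk] := cut_shrink (nbhs_agree (a + b).+1 x0).
have [l hl] := ret_gt (a + b).+1.
exists (maxn K (maxn k l)); split=> [|x xmin]; first exact: leq_maxl.
split; last by apply: hl xmin; lia.
by apply: hk; apply: min_prefixW xmin; lia.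
Qed.

(** Up to the roof, points with equal initial edges move in parallel, and each letter is the letter
    at 0 of an iterate. *)
Lemma return_word_peq k x y : (K <= k)%N -> peq k x y ->
  return_word k x = return_word k y.
Proof.
move=> Kk xy; rewrite /return_word -(peq_ret xy).
apply: (@eq_from_nth _ false); rewrite !size_mkseq // => i ir.
have letterE z : letter z (a + i)%N = letter (iter (a + i) T z) 0.
  by rewrite letter_iter add0r.
rewrite !nth_mkseq // !letterE; apply: letter0K.
by apply: (edges_agreeW Kk); apply: peq_iter xy _; lia.
Qed.

(** At its return the point is again close to [x0], whose zero at [- b - 1] falls [b + 1] places
    before the return. *)
Lemma return_word_last k x : good_level k -> cut k x ->
  exists2 n, ret k x = (n.+1 + b)%N & letter x n = false.
Proof.
move=> [_ gk] xmin; have [_ abr] := gk x xmin.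
have [/(_ (- b.+1%:Z)) xr _] := gk _ (@cut_ret k x).
exists (ret k x - b.+1)%N; first by lia.
rewrite -[RHS]x0b -[RHS]xr; last by lia.
by rewrite letter_iter; congr (letter x _); lia.
Qed.

Lemma return_word_zero_ended k x : good_level k -> cut k x ->
  zero_ended (return_word k x) /\ (1 < size (return_word k x))%N.
Proof.
move=> gk xmin; have [n rE xn] := return_word_last gk xmin.
have [xx abr] := gk.2 x xmin.
have xa : letter x a = false by rewrite -[RHS]x0a -[RHS]xx //; lia.
have -> : return_word k x = mkseq (fun i => letter x (a + i)%N%:Z) (n - a).+1.
  by rewrite /return_word; congr mkseq; lia.
rewrite size_mkseq; split; last by lia.
apply/and3P; split=> //; first by rewrite /= addn0 xa.
rewrite -nth_last size_mkseq nth_mkseq //=.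
by have -> : (a + (n - a) = n)%N by [lia]; rewrite xn.
Qed.

(** Induction on the time [N] of a visit to the roof: the first return word is split off, and the
    return point [y] takes the place of [x]. *)
Lemma return_word_decomposition k N x (S : seq word) : good_level k ->
  (forall y, cut k y -> return_word k y \in S) ->
  cut k x -> top k (iter N T x) ->
  exists t : seq (nat * word), [/\ all (fun p => p.2 \in S) t,
    mkseq (fun i => letter x (a + i)%N%:Z) (N.+1 - b - a) =
      building_word (Building (return_word k x) t) &
    (ret k x < N.+1)%N -> t != [::]].
Proof.
move=> gk kS; elim/ltn_ind: N x => N IHN x xmin xN.
have := ret_min xN; rewrite leq_eqVlt => /predU1P[rN|rN].
  exists [::]; split=> //; last by rewrite rN ltnn.
  by rewrite /building_word /= cats0 /return_word rN.
set r := ret k x in rN *; set y := iter r T x.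
have r0 : (0 < r)%N by [].
have ymin : cut k y := @cut_ret k x.
have yN : top k (iter (N - r) T y) by rewrite /y -iterD subnK.
have [|t [tS tE _]] := IHN (N - r)%N _ y ymin yN; first by lia.
exists ((a + b, return_word k y)%N :: t); split=> //=; first by rewrite kS.
have [_ abr] := gk.2 x xmin; have [yx abr'] := gk.2 y ymin.
have := ret_min yN => rN'.
(* The three lengths are those of the first word, of the gap of ones around the cut at time [r], and
   of the word read from [y]. *)
have -> : (N.+1 - b - a = (r - b - a) + ((a + b) + ((N - r).+1 - b - a)))%N.
  by rewrite /r in rN *; lia.
rewrite mkseq_add [X in _ ++ X]mkseq_add /building_word /=; congr (_ ++ _).
rewrite -catA; congr (_ ++ _).
  apply: (@eq_from_nth _ true); rewrite size_mkseq ?size_nseq // => i iab.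
  rewrite nth_mkseq // nth_nseq if_same.
  have -> : letter x (a + (r - b - a + i))%N = letter y (i%:Z - b%:Z).
    by rewrite letter_iter; congr (letter x _); rewrite /r; lia.
  by rewrite yx; [apply: x0ab; lia | lia].
rewrite -[RHS]tE; apply: eq_mkseq => i; rewrite letter_iter.
by congr (letter x _); rewrite /r; lia.
Qed.

(** * The generating sequence formed by the return words *)

Hypothesis x0_min : path_min (phi x0).

Let cut_x0 k : cut k x0. Proof. by move=> i _; exact: x0_min. Qed.

(** The word of [x0] comes first (and again later) because it has to be
    [v_(i,1)]; [xget] returns [x0] at a vertex [v] where no point is cut. *)
Definition level_list k : seq word := return_word k x0 ::
  [seq return_word k (xget x0 [set y | cut k y /\ src (path_edge (phi y) k) = v])
    | v <- enum (vertex B k)].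

(** The vertex at level [k], the source of the edge of index [k], determines the minimal edges
    before it and hence the return word. *)
Lemma return_word_level_list k x : good_level k -> cut k x ->
  return_word k x \in level_list k.
Proof.
move=> [Kk _] kx; rewrite inE; apply/orP; right; apply/mapP.
exists (src (path_edge (phi x) k)); first by rewrite mem_enum.
case: xgetP => [y _ [ky yx]|/(_ x)[]]; last by split.
by apply/return_word_peq/min_prefix_eq.
Qed.

Lemma level_listP k w : w \in level_list k ->
  exists2 x, cut k x & w = return_word k x.
Proof.
rewrite inE => /predU1P[->|/mapP[v _ ->]]; first by exists x0.
by case: xgetP => [y _ [ky _]|_]; [exists y | exists x0].
Qed.

Lemma level_list_zero_ended k : good_level k -> all zero_ended (level_list k).
Proof.
move=> gk; apply/allP => w /level_listP[x kx ->].
by have [] := return_word_zero_ended gk kx.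
Qed.

Lemma return_word_over_zero k x : good_level k -> cut k x ->
  exists2 bd, is_building [:: [:: false]] (return_word k x) bd &
    building_head bd = [:: false].
Proof.
move=> gk kx; have [w0 w1] := return_word_zero_ended gk kx.
move: w0 w1; case: (return_word k x) => [//|[] // s] w0 w1.
have [|t [tS sE tN]] := @building_over_zero s.
  by case/and3P: w0 => _ _ /= /eqP.
exists (Building [:: false] t) => //; split=> //=.
- by apply: tN; case: (s) w1.
- by rewrite /building_word /= -sE.
Qed.

(** The roof of level [l] lies in that of level [k], so the orbit segment of [x] up to it decomposes
    into return words of level [k]. *)
Lemma return_word_over_level k l x : good_level k -> good_level l ->
  (forall x, cut l x -> peq k x x0) ->
  (forall x, cut l x -> (ret k x < ret l x)%N) -> (k <= l)%N -> cut l x ->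
  exists2 bd, is_building (level_list k) (return_word l x) bd &
    building_head bd = return_word k x0.
Proof.
move=> gk gl lx0 lret kl lx; have kx := min_prefixW kl lx.
have [|t [tS tE tN]] := @return_word_decomposition k (ret l x).-1 x _ gk
  (fun y => @return_word_level_list k y gk) kx.
  exact: max_prefixW kl (@top_ret l x).
exists (Building (return_word k x) t); last exact: return_word_peq gk.1 (lx0 x lx).
split=> //=.
- exact: level_list_zero_ended.
- by have [] := return_word_zero_ended gl lx.
- exact/tN/lret.
- by rewrite tS return_word_level_list.
Qed.

Lemma finite_symbolic_rank_of_towers n : (forall k, (#|vertex B k| <= n)%N) ->
  finite_symbolic_rank X.
Proof.
move=> Bn; have [k0 gk0] := good_level_exists.
have [next nextP] := choice next_level.
pose k_ i := iter i next k0.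
have k_S i : (k_ i < k_ i.+1)%N by have [] := nextP (k_ i).
have gk i : good_level (k_ i).
  by elim: i => [//|i]; apply: good_levelW; exact: ltnW.
have ret_ge i : (i <= ret (k_ i) x0)%N.
  elim: i => [//|i IHi]; apply: leq_ltn_trans IHi _.
  by have [_ _] := nextP (k_ i); apply; exact: cut_x0.
pose W i := if i is i'.+1 then level_list (k_ i') else [:: [:: false]].
(* The rank is [n + 1]: one word per vertex and the additional copy of the word of [x0]. *)
exists n.+1, (fun k => letter x0 (a + k)%N); split=> //; last first.
  exact: word_subshift_forward_word.
apply: (@construction_of_levels _ W) => //.
- by case=> [//|i]; rewrite /= size_map -cardE ltnS Bn.
- case=> [|i] w /level_listP[x kx ->]; first exact: return_word_over_zero.
  have [_ ? ?] := nextP (k_ i).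
  by apply: return_word_over_level => //; exact: ltnW.
(* One unit pays for the index shift in [W], the other for strictness, since the return time of [x0]
   at [k_ i] is at least [i]. *)
move=> k; exists (a + b + k).+2 => //= -[//|i] ki.
have kr : (k < ret (k_ i) x0 - b - a)%N.
  by have := leq_trans ki (ret_ge i : (i.+1 <= _.+1)%N); lia.
by rewrite /= size_mkseq nth_mkseq.
Qed.

End Words.
End Towers.

Theorem corollary8p4 (n : nat) (X : set full_shift) (hX : subshift X) :
  (2 <= n)%N -> minimal_subshift X -> topological_rank (subshift_map hX) n ->
  finite_symbolic_rank X.
Proof.
move=> n2 [_ minX] [[[[[pX cX _ _] _] _] _ [B [hB [conj Bn]]]] _].
have [phi [[phi_cont [psi [_ phiK psiK]]] phiT]] := conj.
have phi_comm x : phi (subshift_map hX x) = vershik_map hB (phi x).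
  by rewrite -[LHS]/((phi \o subshift_map hX) x) phiT.
have [_ [p [pmin pU]]] := hB.
have x0P x : path_min (phi x) -> x = psi p by move=> /pU ->; rewrite phiK.
have x0min : path_min (phi (psi p)) by rewrite psiK.
have [K letter0K] := peq_letter0 cX phi_cont phiK.
have exa := exists_nonneg_zero hX cX pX minX (psi p).
have exb := exists_neg_zero hX cX pX minX (psi p).
have exa' : exists a : nat, ~~ letter (psi p) a.
  by have [a /negbT] := exa; exists a.
have exb' : exists b : nat, ~~ letter (psi p) (- (b.+1%:Z))%R.
  by have [b /negbT] := exb; exists b.
(* Minimality of [a] and [b] gives the zeros nearest to the cut, hence only ones between them. *)
case: (ex_minnP exa') => a /negbTE xa amin.
case: (ex_minnP exb') => b /negbTE xb bmin.
have ones (i : int) : (- b%:Z <= i < a%:Z)%R -> letter (psi p) i = true.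
  case: i => i iab.
    by apply: contraTT (_ : (i < a)%N) => [/amin|]; [rewrite leqNgt | lia].
  apply: contraTT (_ : (i < b)%N) => [|]; last by lia.
  by rewrite NegzE => /bmin; rewrite leqNgt.
apply: (finite_symbolic_rank_of_towers cX pX minX phi_cont psiK phi_comm
  x0P letter0K xa xb ones x0min (n := n)).
by case=> [|k]; [rewrite bratteli_root; exact: ltnW | exact: Bn].
Qed.
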